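(* Let $\phi\in C^4(\mathbb{R})$ be a profile function of a graph-like forward self-similar solution to the planar surface diffusion flow, i.e. $\phi$ satisfies $$\frac{\phi(x_1) - x_1\phi'(x_1)}{4\,v(x_1)} = -\frac{1}{v}\frac{d}{dx_1}\Big(\frac{1}{v}\frac{dk}{dx_1}\Big)\quad\text{for all }x_1\in\mathbb{R},$$ where $v=\sqrt{1+(\phi')^2}$ and $k = \phi''/v^3$. Suppose there are constants $\alpha,\beta\in\mathbb{R}$ such that $$\phi(0)\,\phi(x_1) \le \alpha\, s(x_1) + \beta\quad\text{for all }x_1\in\mathbb{R},$$ where $s(x_1)=\int_0^{x_1} v(z)\,dz$. Then $\phi(x_1) = c x_1$ for some $c\in\mathbb{R}$.
   Context: The displayed equation is the two-dimensional form $\frac{x\cdot\mathbf{n}}{4} = -\partial_s^2 k$ of the profile equation for the curve $\Gamma_*=\{(x_1,\phi(x_1))\}$ with upward unit normal $\mathbf{n}=(-\phi',1)/v$, curvature $k=\phi''/v^3$, and arc-length derivative $\partial_s = v^{-1}\partial_{x_1}$; $\Gamma_t=t^{1/4}\Gamma_*$ then solves $V=-\partial_s^2 k$. *)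

(* Defs.v *)
From Stdlib Require Import Reals.
From Coquelicot Require Import Coquelicot.
Open Scope R_scope.

Definition C4 (phi : R -> R) : Prop :=
  (forall n x, (n <= 4)%nat -> ex_derive_n phi n x) /\
  (forall x, continuous (Derive_n phi 4) x).

Definition vfun (phi : R -> R) (x : R) : R :=
  sqrt (1 + (Derive phi x) ^ 2).

Definition curv (phi : R -> R) (x : R) : R :=
  Derive_n phi 2 x / (vfun phi x) ^ 3.

Definition arclen (phi : R -> R) (x : R) : R :=
  RInt (vfun phi) 0 x.

Definition sd_profile (phi : R -> R) : Prop :=
  forall x : R,
    (phi x - x * Derive phi x) / (4 * vfun phi x)
    = - (1 / vfun phi x) *
        Derive (fun y => (1 / vfun phi y) * Derive (curv phi) y) x.

(* Main.v *)
(** Parametrise by arc length [s] and write [g] for the tangential component of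
    the position [X].  The profile equation gives [g_s = 1 - 4 k k_ss], so
    [F = |X|^2/2 + 2 k^2 - s^2/2] satisfies [F_ss = 4 k_s^2 >= 0].  Since a chord
    is no longer than its arc, [|X|^2 <= s^2 + 2 X.X(0) - |X(0)|^2], and the
    growth hypothesis yields [F - alpha s <= 2 k^2 + const].  If the convex function
    [F - alpha s] had a nonzero slope somewhere, [k^2] would tend to infinity at one
    end, which is impossible because the tangent angle [atan phi'] of a graph,
    whose arc-length derivative is [k], stays bounded.  Hence [F] is affine in
    [s], [k] is constant, and the equation reduces to [phi = x phi']. *)
Require Import Defs.
From Stdlib Require Import Reals Lra.
From Coquelicot Require Import Coquelicot.
Open Scope R_scope.

(* [auto_derive] eta-expands and partially unfolds the functions whose derivatives
   it leaves in the goal, so they have to be matched up to conversion. *)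
Ltac rewrite_derive H :=
  match type of H with
  | is_derive _ ?x ?l =>
      match goal with
      | |- context [Derive ?g x] => rewrite (is_derive_unique g x l H)
      end
  end.

(** * Mean value inequalities *)

Lemma increment_ge (f df : R -> R) (a b m : R) :
  (forall x, is_derive f x (df x)) -> a <= b ->
  (forall x, a <= x <= b -> m <= df x) -> m * (b - a) <= f b - f a.
Proof.
  intros Hf Hab Hm.
  destruct (MVT_gen f a b df) as [c [Hc ->]].
  - intros x _; apply Hf.
  - intros x _; apply continuity_pt_filterlim.
    apply (@ex_derive_continuous _ R_NormedModule).
    exists (df x); apply Hf.
  - rewrite Rmin_left, Rmax_right in Hc by assumption.
    apply Rmult_le_compat_r; [lra | exact (Hm c Hc)].
Qed.

Lemma increment_le (f df : R -> R) (a b m : R) :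
  (forall x, is_derive f x (df x)) -> a <= b ->
  (forall x, a <= x <= b -> df x <= m) -> f b - f a <= m * (b - a).
Proof.
  intros Hf Hab Hm.
  enough (- m * (b - a) <= - f b - - f a) by lra.
  apply (increment_ge (fun x => - f x) (fun x => - df x)); auto.
  - intros x; apply (is_derive_opp f x (df x)), Hf.
  - intros x Hx; specialize (Hm x Hx); lra.
Qed.

Lemma is_derive_0_const (f : R -> R) (x y : R) :
  (forall z, is_derive f z 0) -> f x = f y.
Proof.
  intros Hf.
  assert (H : forall a b, a <= b -> f a = f b).
  { intros a b Hab.
    pose proof (increment_ge f (fun _ => 0) a b 0 Hf Hab (fun _ _ => Rle_refl 0)).
    pose proof (increment_le f (fun _ => 0) a b 0 Hf Hab (fun _ _ => Rle_refl 0)).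
    lra. }
  destruct (Rle_dec x y); [|symmetry]; apply H; lra.
Qed.

(** * Speed, arc length and chords *)

Lemma vfun_ge_1 (phi : R -> R) (x : R) : 1 <= vfun phi x.
Proof.
  unfold vfun; rewrite <- sqrt_1 at 1; apply sqrt_le_1_alt.
  pose proof (pow2_ge_0 (Derive phi x)); lra.
Qed.

Lemma vfun_sqr (phi : R -> R) (x : R) :
  vfun phi x ^ 2 = 1 + Derive phi x ^ 2.
Proof.
  unfold vfun; apply pow2_sqrt.
  pose proof (pow2_ge_0 (Derive phi x)); lra.
Qed.

Lemma C4_is_derive (phi : R -> R) (n : nat) (x : R) :
  C4 phi -> (n < 4)%nat ->
  is_derive (Derive_n phi n) x (Derive_n phi (S n) x).
Proof.
  intros [H _] Hn; apply Derive_correct; exact (H (S n) x Hn).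
Qed.

Lemma vfun_derive (phi : R -> R) (x : R) : C4 phi ->
  is_derive (vfun phi) x (Derive phi x * Derive_n phi 2 x / vfun phi x).
Proof.
  intros HC.
  pose proof (vfun_ge_1 phi x) as Hv; pose proof (vfun_sqr phi x) as Hs.
  assert (H1 : is_derive (Derive phi) x (Derive_n phi 2 x))
    by (apply (C4_is_derive phi 1); auto).
  unfold vfun at 1.
  evar_last.
  - apply (is_derive_comp sqrt (fun x => 1 + Derive phi x ^ 2)).
    + apply is_derive_sqrt; [apply is_derive_id | rewrite <- Hs; nra].
    + apply (is_derive_plus (fun _ => 1) (fun x => Derive phi x ^ 2)).
      * apply is_derive_const.
      * apply is_derive_pow; exact H1.
  - unfold plus, scal, zero, one; simpl; unfold mult; simpl.
    fold (vfun phi x).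
    change (sqrt (1 + Derive phi x * (Derive phi x * 1))) with (vfun phi x).
    field; lra.
Qed.

Lemma arclen_derive (phi : R -> R) (x : R) : C4 phi ->
  is_derive (arclen phi) x (vfun phi x).
Proof.
  intros HC.
  assert (Hc : forall y, continuous (vfun phi) y).
  { intros y; apply (@ex_derive_continuous _ R_NormedModule).
    eexists; apply vfun_derive; exact HC. }
  apply (is_derive_RInt (vfun phi) (arclen phi) 0 x); [|apply Hc].
  apply filter_forall; intros y.
  apply (@RInt_correct R_CompleteNormedModule).
  apply (@ex_RInt_continuous R_CompleteNormedModule).
  intros z _; apply Hc.
Qed.

Lemma arclen_0 (phi : R -> R) : arclen phi 0 = 0.
Proof. exact (RInt_point 0 (vfun phi)). Qed.

(** By Cauchy-Schwarz, the inner product of the chord vector [(x, B)], of length [r], with the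
    tangent [(1, phi')] is at most [r * v] in absolute value. Integrating between [0] and [x] gives
    [r^2 <= r * |s|]. *)
Lemma chord_le_arclen (phi : R -> R) (x : R) : C4 phi ->
  x ^ 2 + (phi x - phi 0) ^ 2 <= arclen phi x ^ 2.
Proof.
  intros HC.
  set (B := phi x - phi 0); set (r := sqrt (x ^ 2 + B ^ 2)).
  assert (Hr0 : 0 <= r) by apply sqrt_pos.
  assert (Hr : r ^ 2 = x ^ 2 + B ^ 2)
    by (apply pow2_sqrt; pose proof (pow2_ge_0 x); pose proof (pow2_ge_0 B); lra).
  assert (Hcs : forall y, Rabs (x + B * Derive phi y) <= r * vfun phi y).
  { intros y.
    pose proof (vfun_ge_1 phi y); pose proof (vfun_sqr phi y).
    rewrite <- (Rabs_pos_eq (r * vfun phi y)) by nra.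
    apply Rsqr_le_abs_0.
    enough (0 <= (r * vfun phi y) ^ 2 - (x + B * Derive phi y) ^ 2)
      by (unfold Rsqr; lra).
    replace ((r * vfun phi y) ^ 2) with (r ^ 2 * vfun phi y ^ 2) by ring.
    rewrite Hr, vfun_sqr.
    (* Lagrange's identity: the defect in Cauchy-Schwarz is the squared determinant. *)
    replace (_ - _) with ((x * Derive phi y - B) ^ 2) by ring.
    apply pow2_ge_0. }
  (* Both choices [e = -1] and [e = 1] give a nondecreasing function; the first serves [0 <= x], the
     second [x < 0], where the signed arc length is negative. *)
  assert (HD : forall e y, is_derive (fun y => r * arclen phi y + e * (x * y + B * phi y)) y
                             (r * vfun phi y + e * (x + B * Derive phi y))).
  { intros e y.
    pose proof (arclen_derive phi y HC).
    assert (H0 : is_derive phi y (Derive phi y))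
      by exact (C4_is_derive phi 0 y HC ltac:(auto)).
    auto_derive.
    - repeat split; eexists; eassumption.
    - rewrite_derive H; rewrite_derive H0; ring. }
  rewrite <- Hr.
  pose proof (arclen_0 phi) as Hs0.
  destruct (Rle_dec 0 x) as [Hx | Hx].
  - pose proof (increment_ge _ _ 0 x 0 (HD (-1)) Hx) as HI; simpl in HI.
    rewrite Hs0 in HI.
    assert (r ^ 2 <= r * arclen phi x).
    { enough (0 * (x - 0) <= r * arclen phi x + -1 * (x * x + B * phi x)
                - (r * 0 + -1 * (x * 0 + B * phi 0))) by (unfold B in *; nra).
      apply HI; intros y _; specialize (Hcs y); apply Rabs_le_between in Hcs; lra. }
    destruct (Req_dec r 0) as [-> | ]; nra.
  - pose proof (increment_ge _ _ x 0 0 (HD 1) ltac:(lra)) as HI; simpl in HI.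
    rewrite Hs0 in HI.
    assert (r ^ 2 <= - (r * arclen phi x)).
    { enough (0 * (0 - x) <= r * 0 + 1 * (x * 0 + B * phi 0)
                - (r * arclen phi x + 1 * (x * x + B * phi x))) by (unfold B in *; nra).
      apply HI; intros y _; specialize (Hcs y); apply Rabs_le_between in Hcs; lra. }
    destruct (Req_dec r 0) as [-> | ]; nra.
Qed.

(** * Curvature and its arc-length derivatives *)

Definition curv_s (phi : R -> R) (x : R) : R :=
  1 / vfun phi x * Derive (curv phi) x.

(** [Derive] is total, so [sd_profile] alone gives no differentiability. This formula supplies it
    for [curv], and, involving derivatives of [phi] up to order three only, also for [curv_s]. *)
Lemma curv_derive_explicit (phi : R -> R) (x : R) : C4 phi ->
  is_derive (curv phi) x
    (Derive_n phi 3 x / vfun phi x ^ 3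
     - 3 * Derive phi x * Derive_n phi 2 x ^ 2 / vfun phi x ^ 5).
Proof.
  intros HC.
  pose proof (vfun_ge_1 phi x).
  pose proof (vfun_derive phi x HC) as Hv.
  pose proof (C4_is_derive phi 2 x HC ltac:(auto)) as H2.
  assert (H1 : is_derive (Derive phi) x (Derive_n phi 2 x))
    by exact (C4_is_derive phi 1 x HC ltac:(auto)).
  unfold curv.
  auto_derive.
  - repeat split; try (eexists; eassumption).
    apply Rgt_not_eq; repeat apply Rmult_lt_0_compat; lra.
  - rewrite_derive Hv; rewrite_derive H2; rewrite_derive H1.
    field; lra.
Qed.

Lemma curv_derive (phi : R -> R) (x : R) : C4 phi ->
  is_derive (curv phi) x (vfun phi x * curv_s phi x).
Proof.
  intros HC.
  evar_last; [apply (Derive_correct (curv phi))|].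
  - eexists; apply curv_derive_explicit; exact HC.
  - unfold curv_s; pose proof (vfun_ge_1 phi x); field; lra.
Qed.

Lemma curv_s_derive (phi : R -> R) (x : R) : C4 phi -> sd_profile phi ->
  is_derive (curv_s phi) x ((x * Derive phi x - phi x) / 4).
Proof.
  intros HC HP.
  pose proof (vfun_ge_1 phi x).
  pose proof (vfun_derive phi x HC) as Hv.
  evar_last; [apply (Derive_correct (curv_s phi))|].
  - apply ex_derive_ext with (fun x => 1 / vfun phi x *
      (Derive_n phi 3 x / vfun phi x ^ 3
       - 3 * Derive phi x * Derive_n phi 2 x ^ 2 / vfun phi x ^ 5)).
    { intros y; unfold curv_s; symmetry; f_equal.
      apply is_derive_unique, curv_derive_explicit; exact HC. }
    assert (H1 : is_derive (Derive phi) x (Derive_n phi 2 x))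
      by exact (C4_is_derive phi 1 x HC ltac:(auto)).
    pose proof (C4_is_derive phi 2 x HC ltac:(auto)) as H2.
    pose proof (C4_is_derive phi 3 x HC ltac:(auto)) as H3.
    auto_derive.
    repeat split; try (eexists; eassumption);
      apply Rgt_not_eq; repeat apply Rmult_lt_0_compat; lra.
  - specialize (HP x).
    (* The body of [curv_s] is literally the inner function of [sd_profile]; multiplying the
       equation by [- v] then isolates its derivative. *)
    change (fun y => _) with (curv_s phi) in HP.
    replace (Derive (curv_s phi) x)
      with (- vfun phi x * (- (1 / vfun phi x) * Derive (curv_s phi) x))
      by (field; lra).
    rewrite <- HP; field; lra.
Qed.

(** Otherwise [k] keeps one sign on the interval, and the tangent angle [atan phi'], whose
    [x]-derivative is [k * v] with [v >= 1], changes by at least 4. Its values lie in an open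
    interval of length [PI <= 4]. *)
Lemma curv_sqr_lt_1 (phi : R -> R) (a : R) : C4 phi ->
  exists x, a <= x <= a + 4 /\ curv phi x ^ 2 < 1.
Proof.
  intros HC.
  destruct (Classical_Prop.classic (exists x, a <= x <= a + 4 /\ curv phi x ^ 2 < 1))
    as [|Hn]; [assumption | exfalso].
  assert (Hk : forall x, a <= x <= a + 4 -> 1 <= curv phi x ^ 2).
  { intros x Hx; apply Rnot_lt_le; intros Hlt; apply Hn; exists x; auto. }
  assert (Ht : forall x, is_derive (fun x => atan (Derive phi x)) x
                           (curv phi x * vfun phi x)).
  { intros x.
    assert (H1 : is_derive (Derive phi) x (Derive_n phi 2 x))
      by exact (C4_is_derive phi 1 x HC ltac:(auto)).
    pose proof (vfun_ge_1 phi x); pose proof (vfun_sqr phi x) as Hs.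
    evar_last.
    - apply (is_derive_comp atan (Derive phi)); [apply is_derive_atan | exact H1].
    - unfold scal; simpl; unfold mult; simpl.
      unfold Rsqr, curv; simpl.
      replace (1 + Derive phi x * Derive phi x) with (vfun phi x ^ 2) by (rewrite Hs; ring).
      field; lra. }
  assert (Hc : forall x, continuity_pt (curv phi) x).
  { intros x; apply continuity_pt_filterlim.
    apply (@ex_derive_continuous _ R_NormedModule).
    eexists; apply curv_derive; exact HC. }
  pose proof (atan_bound (Derive phi a)).
  pose proof (atan_bound (Derive phi (a + 4))).
  pose proof PI_4.
  (* A sign change would produce a zero of [k], against [1 <= k^2]. *)
  assert (Hsgn : forall x y, a <= x <= a + 4 -> a <= y <= a + 4 ->
                   curv phi x < 0 -> 0 < curv phi y -> False).
  { intros x y Hx Hy Hlt Hgt.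
    destruct (IVT_gen (curv phi) x y 0 Hc) as [z [Hz Hz0]].
    - rewrite Rmin_left, Rmax_right by lra; lra.
    - assert (a <= z <= a + 4).
      { split.
        - apply Rle_trans with (2 := proj1 Hz); apply Rmin_glb; lra.
        - apply Rle_trans with (1 := proj2 Hz); apply Rmax_lub; lra. }
      specialize (Hk z ltac:(assumption)); rewrite Hz0 in Hk; lra. }
  destruct (Rle_dec 0 (curv phi a)) as [Ha | Ha].
  - assert (1 * (a + 4 - a) <= atan (Derive phi (a + 4)) - atan (Derive phi a)).
    { apply (increment_ge _ _ a (a + 4) 1 Ht); [lra|].
      intros x Hx; pose proof (Hk x Hx); pose proof (Hk a ltac:(lra)).
      pose proof (vfun_ge_1 phi x).
      assert (~ curv phi x < 0) by (intros Hlt; apply (Hsgn x a); nra).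
      assert (1 <= curv phi x) by nra; nra. }
    lra.
  - assert (atan (Derive phi (a + 4)) - atan (Derive phi a) <= -1 * (a + 4 - a)).
    { apply (increment_le _ _ a (a + 4) (-1) Ht); [lra|].
      intros x Hx; pose proof (Hk x Hx).
      pose proof (vfun_ge_1 phi x).
      assert (~ 0 < curv phi x) by (intros Hlt; apply (Hsgn a x); lra).
      assert (curv phi x <= -1) by nra; nra. }
    lra.
Qed.

(** * The function [F - alpha s] and its convexity in arc length *)

Definition convex_fun (phi : R -> R) (alpha x : R) : R :=
  (x ^ 2 + phi x ^ 2) / 2 + 2 * curv phi x ^ 2
  - arclen phi x ^ 2 / 2 - alpha * arclen phi x.

(* The derivative of [convex_fun] with respect to arc length. *)
Definition convex_slope (phi : R -> R) (alpha x : R) : R :=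
  (x + phi x * Derive phi x) / vfun phi x + 4 * curv phi x * curv_s phi x
  - arclen phi x - alpha.

Lemma convex_fun_derive (phi : R -> R) (alpha x : R) : C4 phi ->
  is_derive (convex_fun phi alpha) x (vfun phi x * convex_slope phi alpha x).
Proof.
  intros HC.
  pose proof (vfun_ge_1 phi x).
  pose proof (arclen_derive phi x HC) as Hs.
  pose proof (curv_derive phi x HC) as Hk.
  assert (H0 : is_derive phi x (Derive phi x))
      by exact (C4_is_derive phi 0 x HC ltac:(auto)).
  unfold convex_fun, convex_slope.
  auto_derive.
  - repeat split; eexists; eassumption.
  - rewrite_derive Hs; rewrite_derive Hk.
    rewrite_derive H0; field; lra.
Qed.

(** In arc length, the tangential component of [X] has derivative [1 + k (X.n) = 1 - 4 k k_ss]; the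
    [k k_ss] term cancels against that of [(4 k k_s)_s], and the [1] against [s_s]. Only [4 k_s^2]
    remains. *)
Lemma convex_slope_derive (phi : R -> R) (alpha x : R) : C4 phi -> sd_profile phi ->
  is_derive (convex_slope phi alpha) x (4 * vfun phi x * curv_s phi x ^ 2).
Proof.
  intros HC HP.
  pose proof (vfun_ge_1 phi x).
  pose proof (vfun_sqr phi x) as Hv2.
  pose proof (vfun_derive phi x HC) as Hv.
  pose proof (arclen_derive phi x HC) as Hs.
  pose proof (curv_derive phi x HC) as Hk.
  pose proof (curv_s_derive phi x HC HP) as Hw.
  assert (H0 : is_derive phi x (Derive phi x))
      by exact (C4_is_derive phi 0 x HC ltac:(auto)).
  assert (H1 : is_derive (Derive phi) x (Derive_n phi 2 x))
      by exact (C4_is_derive phi 1 x HC ltac:(auto)).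
  unfold convex_slope.
  auto_derive.
  - repeat split; try (eexists; eassumption); lra.
  - rewrite_derive Hs; rewrite_derive Hk; rewrite_derive Hv; rewrite_derive Hw.
    rewrite_derive H0; rewrite_derive H1.
    (* The identity holds modulo [v^2 = 1 + phi'^2], so [phi'^2] is eliminated both before and after
       the denominators are cleared. *)
    unfold curv.
    replace (Derive phi x ^ 2) with (vfun phi x ^ 2 - 1) by lra.
    field_simplify; try lra.
    replace (Derive phi x ^ 2) with (vfun phi x ^ 2 - 1) by lra.
    field; lra.
Qed.

(** * From vanishing slope to a straight line *)

Theorem theorem3p2 (phi : R -> R) :
  C4 phi ->
  sd_profile phi ->
  (exists alpha beta : R,
      forall x : R, phi 0 * phi x <= alpha * arclen phi x + beta) ->
  exists c : R, forall x : R, phi x = c * x.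
Proof.
  intros HC HP [alpha [beta Hab]].
  set (G := convex_fun phi alpha); set (H := convex_slope phi alpha).
  assert (HG : forall x, is_derive G x (vfun phi x * H x))
    by (intros x; apply convex_fun_derive; exact HC).
  assert (HH : forall x, is_derive H x (4 * vfun phi x * curv_s phi x ^ 2))
    by (intros x; apply convex_slope_derive; assumption).
  assert (Hmono : forall x y, x <= y -> H x <= H y).
  { intros x y Hxy.
    enough (0 * (y - x) <= H y - H x) by lra.
    apply (increment_ge _ _ x y 0 HH Hxy).
    intros z _; pose proof (vfun_ge_1 phi z); pose proof (pow2_ge_0 (curv_s phi z)); nra. }
  (* As [X(0) = (0, phi 0)], the chord bound gives [(|X|^2 - s^2)/2 <= phi 0 * phi x - (phi 0)^2/2],
     to which the growth hypothesis applies. *)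
  assert (Hbound : forall x, G x <= 2 * curv phi x ^ 2 + beta).
  { intros x; unfold G, convex_fun.
    pose proof (chord_le_arclen phi x HC); specialize (Hab x).
    pose proof (pow2_ge_0 (phi 0)); nra. }
  assert (H0 : forall x, H x = 0).
  { intros x.
    destruct (Rtotal_order (H x) 0) as [Hneg | [Hz | Hpos]]; [|exact Hz|]; exfalso.
    (* Going left by [T] or more lifts [G] to at least [beta + 2], since [v >= 1] and the slope
       stays below [H x]. A point with [k^2 < 1] in the window of length 4 beyond contradicts
       [Hbound]. *)
    - set (T := (Rabs (beta + 2 - G x)) / - H x).
      assert (HT : T * - H x = Rabs (beta + 2 - G x)) by (unfold T; field; lra).
      pose proof (Rle_abs (beta + 2 - G x)).
      pose proof (Rabs_pos (beta + 2 - G x)).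
      assert (0 <= T) by nra.
      destruct (curv_sqr_lt_1 phi (x - T - 4) HC) as [y [Hy Hk]].
      assert (G x - G y <= H x * (x - y)).
      { apply (increment_le _ _ y x (H x) HG); [lra|].
        intros z Hz; pose proof (vfun_ge_1 phi z); pose proof (Hmono z x ltac:(lra)); nra. }
      pose proof (Hbound y); nra.
    (* The mirror image, going right. *)
    - set (T := (Rabs (beta + 2 - G x)) / H x).
      assert (HT : T * H x = Rabs (beta + 2 - G x)) by (unfold T; field; lra).
      pose proof (Rle_abs (beta + 2 - G x)).
      pose proof (Rabs_pos (beta + 2 - G x)).
      assert (0 <= T) by nra.
      destruct (curv_sqr_lt_1 phi (x + T) HC) as [y [Hy Hk]].
      assert (H x * (y - x) <= G y - G x).
      { apply (increment_ge _ _ x y (H x) HG); [lra|].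
        intros z Hz; pose proof (vfun_ge_1 phi z); pose proof (Hmono x z ltac:(lra)); nra. }
      pose proof (Hbound y); nra. }
  assert (Hw : forall x, curv_s phi x = 0).
  { intros x.
    pose proof (vfun_ge_1 phi x).
    assert (Hd : 4 * vfun phi x * curv_s phi x ^ 2 = 0).
    { rewrite <- (is_derive_unique _ _ _ (HH x)).
      rewrite (Derive_ext H (fun _ => 0) x H0); apply Derive_const. }
    nra. }
  assert (Hlin : forall x, phi x = x * Derive phi x).
  { intros x.
    pose proof (is_derive_unique _ _ _ (curv_s_derive phi x HC HP)) as Hd.
    rewrite (Derive_ext _ (fun _ => 0) x Hw), Derive_const in Hd; lra. }
  (* Differentiating [phi = x phi'] yields [x phi'' = 0], which is void at [0]. It is used at [1]
     only, and the constancy of [k] carries the conclusion to every point. *)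
  assert (Hpp1 : Derive_n phi 2 1 = 0).
  { assert (D1 : is_derive (Derive phi) 1 (Derive_n phi 2 1))
      by exact (C4_is_derive phi 1 1 HC ltac:(auto)).
    assert (D : is_derive (fun x => x * Derive phi x) 1
                  (Derive phi 1 + Derive_n phi 2 1)).
    { auto_derive; [repeat split; eexists; eassumption|].
      rewrite_derive D1; ring. }
    enough (Derive phi 1 = Derive phi 1 + Derive_n phi 2 1) by lra.
    rewrite <- (is_derive_unique _ _ _ D); exact (Derive_ext _ _ 1 Hlin). }
  assert (Hpp : forall x, Derive_n phi 2 x = 0).
  { intros x.
    assert (Hk : curv phi x = 0).
    { rewrite (is_derive_0_const (curv phi) x 1).
      - unfold curv; rewrite Hpp1; unfold Rdiv; ring.
      - intros z; evar_last; [apply curv_derive; exact HC | rewrite Hw; ring]. }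
    pose proof (vfun_ge_1 phi x).
    replace (Derive_n phi 2 x) with (curv phi x * vfun phi x ^ 3)
      by (unfold curv; field; lra).
    rewrite Hk; ring. }
  exists (Derive phi 0); intros x.
  rewrite (is_derive_0_const (Derive phi) 0 x).
  - rewrite Rmult_comm; apply Hlin.
  - intros z; rewrite <- (Hpp z); apply (C4_is_derive phi 1); auto.
Qed.
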